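(* Let $M$ be a smooth $3$-manifold with a projective structure $[\nabla]$, let $W_{ab}{}^c{}_d$ be its projective Weyl tensor, let $\epsilon^{abc}$ be a nowhere-vanishing section of $\Lambda^3(TM)$ with dual $3$-form $\epsilon_{abc}$ normalised by $\epsilon^{abc}\epsilon_{abc}=6$, and put $V^{ab}{}_c=\epsilon^{dea}W_{de}{}^b{}_c$. In order that $[\nabla]$ be metrisable, the invariant tensor $$Q_{ab}{}^c=\epsilon_{pq(a}V^{pr}{}_{b)}V^{qc}{}_r$$ must vanish identically, whilst in general it does not (i.e. there exist $3$-dimensional projective structures for which $Q_{ab}{}^c$ is not identically zero).
   Context: Abstract index notation is used; a repeated index denotes contraction, round brackets on indices denote symmetrisation (in $\epsilon_{pq(a}V^{pr}{}_{b)}$ over the indices $a,b$), square brackets skew-symmetrisation. A projective structure $[\nabla]$ is an equivalence class of torsion-free connections on $TM$, where $\nabla\sim\hat\nabla$ if there is a $1$-form $\Upsilon_a$ with $\hat\nabla_aX^b=\nabla_aX^b+\Upsilon_aX^b+\delta_a{}^b\Upsilon_cX^c$. It is metrisable if it contains the Levi-Civita connection of some (pseudo-)Riemannian metric. The curvature of $\nabla\in[\nabla]$ is defined by $[\nabla_a,\nabla_b]X^c=R_{ab}{}^c{}_dX^d$. It decomposes uniquely as $R_{ab}{}^c{}_d=W_{ab}{}^c{}_d+\delta_a{}^c\mathrm{P}_{bd}-\delta_b{}^c\mathrm{P}_{ad}+\beta_{ab}\delta_d{}^c$ with $\beta_{ab}=-2\mathrm{P}_{[ab]}$ and $W_{ab}{}^c{}_d$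 totally trace-free; $W_{ab}{}^c{}_d$ is the projective Weyl tensor, and it depends only on $[\nabla]$. A different choice of $\epsilon^{abc}$ only rescales $Q_{ab}{}^c$ pointwise by a non-zero factor. *)

(* Defs.v *)
From HB Require Import structures.
From mathcomp Require Import all_boot all_order all_algebra.
From mathcomp Require Import all_classical all_reals all_analysis.

Set Implicit Arguments.
Unset Strict Implicit.
Unset Printing Implicit Defensive.

Import Order.TTheory GRing.Theory Num.Theory.
Import numFieldNormedType.Exports.

Local Open Scope classical_set_scope.
Local Open Scope ring_scope.

(* Geometric objects on a 3-manifold are given by their components in the
   charts of a fixed atlas.  Components are functions of the coordinates
   x : 'rV[R]_3 of a point; only their values on the (open) coordinate domain
   of the chart are meaningful.  Index positions are recorded by the order of
   the arguments, reading the tensor symbol from left to right, e.g. the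
   argument list a b c d of R_{ab}{}^c{}_d. *)

Section Smooth.
Variable R : realType.

Definition partial (a : 'I_3) (f : 'rV[R]_3 -> R) : 'rV[R]_3 -> R :=
  fun x => 'D_(delta_mx 0 a) (f : 'rV[R]_3 -> R^o) x.

Definition iter_partial (s : seq 'I_3) (f : 'rV[R]_3 -> R) : 'rV[R]_3 -> R :=
  foldr partial f s.

(* C^infinity on an open set D: all iterated partial derivatives exist and are
   continuous at every point of D. *)
Definition smooth_on (D : set 'rV[R]_3) (f : 'rV[R]_3 -> R) : Prop :=
  forall (s : seq 'I_3) (x : 'rV[R]_3), D x ->
    {for x, continuous (iter_partial s f)} /\
    forall a : 'I_3,
      derivable (iter_partial s f : 'rV[R]_3 -> R^o) x (delta_mx 0 a).

End Smooth.

Section Manifold.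
Variable R : realType.

(* [chart_map] and [chart_inv] are total functions, constrained only on the chart
   domain and on its image, where they are mutually inverse
   homeomorphisms. *)
Record chart (T : topologicalType) := Chart {
  chart_dom : set T;
  chart_map : T -> 'rV[R]_3;
  chart_inv : 'rV[R]_3 -> T;
  chart_dom_open : open chart_dom;
  chart_img_open : open (chart_map @` chart_dom);
  chart_map_cts : forall p, chart_dom p -> {for p, continuous chart_map};
  chart_inv_cts : forall x, (chart_map @` chart_dom) x -> {for x, continuous chart_inv};
  chart_mapK : forall p, chart_dom p -> chart_inv (chart_map p) = p }.

Definition chart_img (T : topologicalType) (c : chart T) : set 'rV[R]_3 :=
  chart_map c @` chart_dom c.

Definition overlap (T : topologicalType) (c d : chart T) : set 'rV[R]_3 :=
  chart_map c @` (chart_dom c `&` chart_dom d).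

Definition transition (T : topologicalType) (c d : chart T) :
  'rV[R]_3 -> 'rV[R]_3 := fun x => chart_map d (chart_inv c x).

(* jac c d x a b is dy^b / dx^a, where y are the coordinates of [d] and x those
   of [c]. *)
Definition jac (T : topologicalType) (c d : chart T) (x : 'rV[R]_3)
  (a b : 'I_3) : R := partial a (fun z => transition c d z 0 b) x.

Record manifold3 := Manifold3 {
  carrier :> topologicalType;
  mhausdorff : hausdorff_space carrier;
  msecond : @second_countable carrier;
  atlas : Type;
  ch : atlas -> chart carrier;
  ch_cover : forall p : carrier, exists i, chart_dom (ch i) p;
  ch_smooth : forall (i j : atlas) (b : 'I_3),
    smooth_on (overlap (ch i) (ch j))
              (fun x => transition (ch i) (ch j) x 0 b) }.

End Manifold.

Section Tensors.
Variables (R : realType) (M : manifold3 R).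

Let J (i j : atlas M) := jac (ch i) (ch j).
Let tr (i j : atlas M) := transition (ch i) (ch j).
Let ov (i j : atlas M) := overlap (ch i) (ch j).

(* Throughout, upper indices are pushed forward along the transition map and
   lower indices are pulled back. *)

Record oneform := OneForm {
  of_comp :> atlas M -> 'rV[R]_3 -> 'I_3 -> R;
  of_smooth : forall i a, smooth_on (chart_img (ch i)) (fun x => of_comp i x a);
  of_trans : forall i j x, ov i j x -> forall a,
    of_comp i x a = \sum_a' J i j x a a' * of_comp j (tr i j x) a' }.

(* The signature is not required to be constant over the components of M. *)
Record pseudo_metric := PseudoMetric {
  g_comp :> atlas M -> 'rV[R]_3 -> 'I_3 -> 'I_3 -> R;
  g_smooth : forall i a b,
    smooth_on (chart_img (ch i)) (fun x => g_comp i x a b);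
  g_sym : forall i x, chart_img (ch i) x -> forall a b,
    g_comp i x a b = g_comp i x b a;
  g_nondeg : forall i x, chart_img (ch i) x ->
    \det (\matrix_(a, b) g_comp i x a b) != 0;
  g_trans : forall i j x, ov i j x -> forall a b,
    g_comp i x a b =
    \sum_a' \sum_b' J i j x a a' * J i j x b b' * g_comp j (tr i j x) a' b' }.

Definition skew3 (t : 'I_3 -> 'I_3 -> 'I_3 -> R) : Prop :=
  forall a b c, t b a c = - t a b c /\ t a c b = - t a b c.

Record trivector := Trivector {
  tv_comp :> atlas M -> 'rV[R]_3 -> 'I_3 -> 'I_3 -> 'I_3 -> R;
  tv_smooth : forall i a b c,
    smooth_on (chart_img (ch i)) (fun x => tv_comp i x a b c);
  tv_skew : forall i x, chart_img (ch i) x -> skew3 (tv_comp i x);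
  tv_trans : forall i j x, ov i j x -> forall a' b' c',
    tv_comp j (tr i j x) a' b' c' =
    \sum_a \sum_b \sum_c
      J i j x a a' * J i j x b b' * J i j x c c' * tv_comp i x a b c }.

Record threeform := ThreeForm {
  tf_comp :> atlas M -> 'rV[R]_3 -> 'I_3 -> 'I_3 -> 'I_3 -> R;
  tf_smooth : forall i a b c,
    smooth_on (chart_img (ch i)) (fun x => tf_comp i x a b c);
  tf_skew : forall i x, chart_img (ch i) x -> skew3 (tf_comp i x);
  tf_trans : forall i j x, ov i j x -> forall a b c,
    tf_comp i x a b c =
    \sum_a' \sum_b' \sum_c'
      J i j x a a' * J i j x b b' * J i j x c c' *
      tf_comp j (tr i j x) a' b' c' }.

Definition nowhere_vanishing (e : trivector) : Prop :=
  forall i x, chart_img (ch i) x -> exists a b c, e i x a b c != 0.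

Definition dual_threeform (e : trivector) (e' : threeform) : Prop :=
  forall i x, chart_img (ch i) x ->
    \sum_a \sum_b \sum_c e i x a b c * e' i x a b c = 6.

(* A connection on TM: Gam i x a b c is the Christoffel symbol
   Gamma_a{}^b{}_c in nabla_a X^b = partial_a X^b + Gamma_a{}^b{}_c X^c. The
   transformation law says exactly that nabla_a X^b is a tensor. *)
Record connection := Connection {
  Gam :> atlas M -> 'rV[R]_3 -> 'I_3 -> 'I_3 -> 'I_3 -> R;
  Gam_smooth : forall i a b c,
    smooth_on (chart_img (ch i)) (fun x => Gam i x a b c);
  Gam_trans : forall i j x, ov i j x -> forall a b' c,
    \sum_b Gam i x a b c * J i j x b b' =
    partial a (fun z => J i j z c b') x +
    \sum_a' \sum_c' J i j x a a' * J i j x c c' *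
      Gam j (tr i j x) a' b' c' }.

Definition torsion_free (n : connection) : Prop :=
  forall i x, chart_img (ch i) x -> forall a b c, n i x a b c = n i x c b a.

(* A smooth vector field on the domain of the chart i. *)
Definition vfield (i : atlas M) (X : 'rV[R]_3 -> 'I_3 -> R) : Prop :=
  forall a, smooth_on (chart_img (ch i)) (fun x => X x a).

(* nabla_a X^b *)
Definition cov_vec (n : connection) (i : atlas M)
    (X : 'rV[R]_3 -> 'I_3 -> R) (x : 'rV[R]_3) (a b : 'I_3) : R :=
  partial a (fun z => X z b) x + \sum_c n i x a b c * X x c.

(* nabla_a T_b{}^c *)
Definition cov_mixed (n : connection) (i : atlas M)
    (T : 'rV[R]_3 -> 'I_3 -> 'I_3 -> R) (x : 'rV[R]_3) (a b c : 'I_3) : R :=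
  partial a (fun z => T z b c) x
  - (\sum_d n i x a d b * T x d c) + \sum_d n i x a c d * T x b d.

(* nabla_a g_{bc} *)
Definition cov_metric (n : connection) (i : atlas M)
    (g : 'rV[R]_3 -> 'I_3 -> 'I_3 -> R) (x : 'rV[R]_3) (a b c : 'I_3) : R :=
  partial a (fun z => g z b c) x
  - (\sum_d n i x a d b * g x d c) - \sum_d n i x a d c * g x b d.

Definition levi_civita (g : pseudo_metric) (n : connection) : Prop :=
  torsion_free n /\
  forall i x, chart_img (ch i) x -> forall a b c, cov_metric n i (g i) x a b c = 0.

Definition proj_equiv (n n' : connection) : Prop :=
  exists U : oneform, forall i X, vfield i X ->
    forall x, chart_img (ch i) x -> forall a b,
      cov_vec n' i X x a b =
      cov_vec n i X x a b + U i x a * X x b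
      + (a == b)%:R * \sum_c U i x c * X x c.

Record projective_structure := ProjectiveStructure {
  pclass : set connection;
  pclassP : exists2 n, torsion_free n &
    pclass = [set n' | torsion_free n' /\ proj_equiv n n'] }.

Definition metrisable (P : projective_structure) : Prop :=
  exists (g : pseudo_metric) (n : connection), pclass P n /\ levi_civita g n.

(* Component arrays.  No transformation law is imposed: the curvature and its
   Weyl part are uniquely determined on each chart by the conditions below, and
   hence transform as tensors. *)
Definition tensor4 :=
  atlas M -> 'rV[R]_3 -> 'I_3 -> 'I_3 -> 'I_3 -> 'I_3 -> R.

(* (nabla_a nabla_b - nabla_b nabla_a) X^c = R_{ab}{}^c{}_d X^d *)
Definition is_curvature (n : connection) (Rm : tensor4) : Prop :=
  forall i X, vfield i X -> forall x, chart_img (ch i) x -> forall a b c,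
    cov_mixed n i (cov_vec n i X) x a b c - cov_mixed n i (cov_vec n i X) x b a c
    = \sum_d Rm i x a b c d * X x d.

Definition trace_free (W : 'I_3 -> 'I_3 -> 'I_3 -> 'I_3 -> R) : Prop :=
  forall a b, [/\ \sum_k W k a k b = 0, \sum_k W a k k b = 0 &
                  \sum_k W a b k k = 0].

(* W is the trace-free part of the curvature of n:  P is the projective Schouten
   tensor and beta_{ab} = - 2 P_{[ab]} = P_{ba} - P_{ab}. *)
Definition weyl_of (n : connection) (W : tensor4) : Prop :=
  exists (Rm : tensor4) (P : atlas M -> 'rV[R]_3 -> 'I_3 -> 'I_3 -> R),
    is_curvature n Rm /\
    forall i x, chart_img (ch i) x ->
      trace_free (W i x) /\
      forall a b c d,
        let beta := P i x b a - P i x a b in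
        Rm i x a b c d =
        W i x a b c d + (a == c)%:R * P i x b d - (b == c)%:R * P i x a d
        + beta * (d == c)%:R.

(* The Weyl tensor computed from some connection of the class; it does not
   depend on the choice. *)
Definition projective_weyl (P : projective_structure) (W : tensor4) : Prop :=
  exists n, pclass P n /\ weyl_of n W.

(* V^{ab}{}_c *)
Definition Vtensor (e : trivector) (W : tensor4) (i : atlas M) (x : 'rV[R]_3)
    (a b c : 'I_3) : R :=
  \sum_d \sum_f e i x d f a * W i x d f b c.

(* Q_{ab}{}^c, with (1/2) in the symmetrisation over a, b. *)
Definition Qtensor (e : trivector) (e' : threeform) (W : tensor4)
    (i : atlas M) (x : 'rV[R]_3) (a b c : 'I_3) : R :=
  let V := Vtensor e W i x in
  let S a b := \sum_p \sum_q \sum_r e' i x p q a * V p r b * V q c r in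
  2^-1 * (S a b + S b a).

End Tensors.

(* Main.v *)
Require Import Defs.
From HB Require Import structures.
From mathcomp Require Import all_boot all_order all_algebra.
From mathcomp Require Import all_classical all_reals all_analysis.
From mathcomp Require Import ring lra.

Set Implicit Arguments.
Unset Strict Implicit.
Unset Printing Implicit Defensive.

Import Order.TTheory GRing.Theory Num.Theory.
Import numFieldNormedType.Exports.

Local Open Scope classical_set_scope.
Local Open Scope ring_scope.

(** Vanishing.  Fix a chart, a point, and write eta for the Levi-Civita symbol.
    Let K be the curvature of the Levi-Civita connection of g, and h the inverse
    of g.  The lowered tensor g_{ce} K_{ab}^e_d is skew in ab (trivially), skew
    in cd ([levi_civita_skew]: second partial derivatives of g commute) and
    satisfies the Bianchi identity ([curvature_bianchi]: no torsion).  In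
    dimension three a skew pair of indices is the same thing as one index, by
    contraction with eta ([dualK]), so that lowered tensor is
    eta_{abp} eta_{cdq} G^{pq}, and the Bianchi identity says that G is
    symmetric ([einstein_sym]).

    Another connection of the projective class has curvature
    K + delta_b^c A_{ad} - delta_a^c A_{bd} + B_{ab} delta_d^c
    ([curvature_proj_shift]), of the same shape as the trace terms that are
    removed to get W.  Hence W - K is of this shape with unknown A and B, and
    trace-freeness pins V down without computing them: the traces force
    V^{ab}_c to be symmetric in ab, symmetrisation kills the A term, and the
    remaining trace of V kills B.  What is left is ([weyl_dualE]), up to scale,
    V^{ab}_c = u^{ab}_c + u^{ba}_c   with
    u^{ab}_c = G^{aq} eta_{ecq} h^{be}.

    For V of this form with G and h symmetric, Q vanishes identically
    ([upart_quadratic]).  The reason: Q is polynomial in (G, h), and a generic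
    pair of symmetric forms is simultaneously diagonal in a suitable basis over
    the complex numbers.  There V^{ab}_c is zero unless a, b, c are distinct, so
    in V^{pr}_b V^{qc}_r both {p, b} and {q, c} are the complement of r; as p
    and q differ, q = b and p = c, and only
    eta_{cba} (V^{ca}_b V^{bc}_a - V^{cb}_a V^{ac}_b) with a, b, c distinct
    survives, which is zero by the symmetry of V.  Since the identity involves
    only polynomials, it is checked by expansion.

    Non-vanishing.  On R^3 take the constant symbols Gamma_a^{a+1}_a = 1, with
    indices modulo 3, and all others zero.  Its curvature
    consists of commutators of the elementary matrices Gamma_a = E_{a+1,a}; it is
    trace-free, so it is its own Weyl tensor, and Q_{00}^1 = -4 ([cyc_Qtensor]). *)

(** * Sums over three indices *)

Definition o0 : 'I_3 := Ordinal (isT : 0 < 3)%N.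
Definition o1 : 'I_3 := Ordinal (isT : 1 < 3)%N.
Definition o2 : 'I_3 := Ordinal (isT : 2 < 3)%N.

Lemma sum3 (V : nmodType) (F : 'I_3 -> V) :
  \sum_k F k = F o0 + F o1 + F o2.
Proof.
rewrite !big_ord_recl big_ord0 addr0 addrA.
by congr (F _ + F _ + F _); apply: val_inj.
Qed.

Lemma ord3_ind (P : 'I_3 -> Prop) : P o0 -> P o1 -> P o2 -> forall a, P a.
Proof.
move=> P0 P1 P2 [[|[|[|//]]] lt].
- by rewrite (_ : Ordinal lt = o0) //; exact: val_inj.
- by rewrite (_ : Ordinal lt = o1) //; exact: val_inj.
- by rewrite (_ : Ordinal lt = o2) //; exact: val_inj.
Qed.

Lemma sum_deltal (V : pzRingType) (F : 'I_3 -> V) a :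
  \sum_k (a == k)%:R * F k = F a.
Proof.
rewrite sum3; elim/ord3_ind: a; rewrite -!val_eqE /=;
  by rewrite mul1r !mul0r ?addr0 ?add0r.
Qed.

Lemma sum_deltar (V : pzRingType) (F : 'I_3 -> V) a :
  \sum_k (k == a)%:R * F k = F a.
Proof. by under eq_bigr do rewrite eq_sym; exact: sum_deltal. Qed.

(** * Symmetry of second derivatives *)

Section SecondDerivatives.
Variables (R : realType) (V : normedModType R).
Implicit Types (f : V -> R^o) (v w x y : V).

Lemma is_derive_line f v y (s : R) : derivable f (s *: v + y) v ->
  is_derive s 1 (fun t : R => f (t *: v + y)) ('D_v f (s *: v + y)).
Proof.
move=> df.
have E : (fun h : R => h^-1 *:
    (((fun t : R => f (t *: v + y)) \o shift s) (h *: (1 : R^o)) -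
     f (s *: v + y))) =
  (fun h => h^-1 *: ((f \o shift (s *: v + y)) (h *: v) - f (s *: v + y))).
  apply/funext => h /=; congr (_ *: (f _ - _)).
  by rewrite [h *: _]mulr1 scalerDl addrA.
by split; rewrite /derivable /derive E.
Qed.

Lemma MVT_line f v y (h : R) : 0 < h ->
  (forall s, 0 <= s <= h -> derivable f (s *: v + y) v) ->
  exists2 s, 0 <= s <= h & f (h *: v + y) - f y = h * 'D_v f (s *: v + y).
Proof.
move=> h0 df.
have dl s : 0 <= s <= h ->
    is_derive s 1 (fun t : R => f (t *: v + y)) ('D_v f (s *: v + y)).
  by move=> /df /is_derive_line.
have [|||c ch E] := @MVT_segment R (fun t : R => f (t *: v + y))
    (fun s => 'D_v f (s *: v + y)) 0 h.
- exact: ltW.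
- by move=> s /itvP sh; apply: dl; rewrite !sh.
- apply: derivable_within_continuous => s /itvP sh.
  by have [] := dl s _; rewrite ?sh.
exists c; first by move/itvP: ch => ch; rewrite !ch.
by move: E; rewrite scale0r add0r subr0 mulrC.
Qed.

(** Apply the mean value theorem twice: along v to y |-> f (h w + y) - f y, then
    along w to the resulting difference of values of D_v f. *)
Lemma second_difference f v w x (h : R) : 0 < h ->
  (forall s t, 0 <= s <= h -> 0 <= t <= h ->
     derivable f (s *: v + (t *: w + x)) v /\
     derivable ('D_v f) (t *: w + (s *: v + x)) w) ->
  exists s t, [/\ 0 <= s <= h, 0 <= t <= h &
    f (h *: v + (h *: w + x)) - f (h *: v + x) - (f (h *: w + x) - f x) =
    h * (h * 'D_w ('D_v f) (t *: w + (s *: v + x)))].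
Proof.
move=> h0 df.
have h00 : 0 <= (0 : R) <= h by rewrite lexx ltW.
have hh : 0 <= h <= h by rewrite lexx ltW.
pose g y := f (h *: w + y) - f y : R^o.
have dg s : 0 <= s <= h -> is_derive (s *: v + x) v g
    ('D_v f (h *: w + (s *: v + x)) - 'D_v f (s *: v + x)).
  move=> sh; apply: is_deriveB; last first.
    by apply: derivableP; have [] := df _ _ sh h00; rewrite scale0r add0r.
  have := df _ _ sh hh; rewrite addrCA => -[dfh _].
  have E : (fun k : R => k^-1 *: (((fun y => f (h *: w + y)) \o
        shift (s *: v + x)) (k *: v) - f (h *: w + (s *: v + x)))) =
     (fun k => k^-1 *: ((f \o shift (h *: w + (s *: v + x))) (k *: v) -
       f (h *: w + (s *: v + x)))).
    by apply/funext => k /=; rewrite addrCA.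
  by split; rewrite /derivable /derive E.
have [s sh Es] := @MVT_line g v x h h0 (fun s sh => @ex_derive _ _ _ _ _ _ _ (dg s sh)).
have [t th Et] := @MVT_line ('D_v f) w (s *: v + x) h h0
  (fun t th => (df _ _ sh th).2).
exists s, t; split => //; rewrite -Et -(@derive_val _ _ _ _ _ _ _ (dg s sh)) -Es.
by rewrite /g; congr (f _ - _ - _); rewrite addrCA.
Qed.

Lemma near_parallelogram (P : set V) v w x : nbhs x P ->
  exists2 h : R, 0 < h & forall s t, 0 <= s <= h -> 0 <= t <= h ->
    P (s *: v + (t *: w + x)).
Proof.
move=> /nbhs_ballP[e /= e0 xeP].
have M0 : 0 < `|v| + `|w| + 1 by rewrite ltr_wpDl // addr_ge0.
exists (e / (`|v| + `|w| + 1)); first by rewrite divr_gt0.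
move=> s t /andP[s0 sh] /andP[t0 th]; apply: xeP.
rewrite -ball_normE /= addrA opprD addrCA subrr addr0 normrN.
apply: le_lt_trans (ler_normD _ _) _; rewrite !normrZ !ger0_norm //.
apply: (@le_lt_trans _ _ (e / (`|v| + `|w| + 1) * (`|v| + `|w|))).
  by rewrite mulrDr lerD // ler_wpM2r.
by rewrite -mulrA gtr_pMr // ltr_pdivrMl // mulr1 ltrDl.
Qed.

(** The second difference of f over a small parallelogram is symmetric in v and w,
    and h^-2 times it is a value of either mixed derivative near x; continuity at x
    then forces the two limits to agree. *)
Lemma derive_swap f v w x :
  (\forall z \near x, [/\ derivable f z v, derivable f z w,
     derivable ('D_v f) z w & derivable ('D_w f) z v]) ->
  {for x, continuous ('D_w ('D_v f))} -> {for x, continuous ('D_v ('D_w f))} ->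
  'D_w ('D_v f) x = 'D_v ('D_w f) x.
Proof.
move=> df c1 c2; apply/eqP; rewrite -subr_eq0 -normr_eq0; apply/negPn/negP => D0.
pose d : R := `|'D_w ('D_v f) x - 'D_v ('D_w f) x| / 2.
have d0 : 0 < d by rewrite divr_gt0 // lt_neqAle eq_sym D0 normr_ge0.
have n1 : \forall z \near x, `|'D_w ('D_v f) x - 'D_w ('D_v f) z| < d.
  by move/cvgrPdist_lt: c1 => /(_ _ d0).
have n2 : \forall z \near x, `|'D_v ('D_w f) x - 'D_v ('D_w f) z| < d.
  by move/cvgrPdist_lt: c2 => /(_ _ d0).
have [h h0 Ph] := near_parallelogram v w (filterI df (filterI n1 n2)).
have [s [t [sh th E1]]] := @second_difference f v w x h h0 (fun s t sh th =>
  conj (let: And4 p _ _ _ := (Ph s t sh th).1 in p)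
    (eq_rect _ (fun z => derivable _ z _)
      (let: And4 _ _ p _ := (Ph s t sh th).1 in p) _ (addrCA _ _ _))).
have [t' [s' [th' sh' E2]]] := @second_difference f w v x h h0 (fun t s th sh =>
  conj (eq_rect _ (fun z => derivable _ z _)
      (let: And4 _ p _ _ := (Ph s t sh th).1 in p) _ (addrCA _ _ _))
   (let: And4 _ _ _ p := (Ph s t sh th).1 in p)).
have E : 'D_w ('D_v f) (t *: w + (s *: v + x)) =
         'D_v ('D_w f) (s' *: v + (t' *: w + x)).
  apply: (mulfI (lt0r_neq0 h0)); apply: (mulfI (lt0r_neq0 h0)).
  rewrite (_ : h *: w + (h *: v + x) = h *: v + (h *: w + x)) in E2;
    last exact: addrCA.
  apply: etrans (esym E1) _; apply: etrans _ E2.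
  set A : R := f _; set B : R := f _.
  by set C : R := f _; set D : R := f _; ring.
have [_ [+ _]] := Ph _ _ sh th; have [_ [_ +]] := Ph _ _ sh' th'.
rewrite -E (addrCA (s *: v)) /=.
set z : R := 'D_w ('D_v f) (_ + _) => b2 b1.
have : `|'D_w ('D_v f) x - 'D_v ('D_w f) x| < d + d.
  apply: le_lt_trans (ltrD b1 b2).
  rewrite [X in _ <= _ + X]distrC.
  by apply: le_trans (ler_normD _ _); rewrite addrA subrK.
by rewrite -splitr ltxx.
Qed.

End SecondDerivatives.

(** * Coordinate partial derivatives *)

Section Partial.
Variable R : realType.
Implicit Types (f g : 'rV[R]_3 -> R) (x : 'rV[R]_3) (a b : 'I_3)
  (D : set 'rV[R]_3).

Definition has_partial f x a :=
  derivable (f : 'rV[R]_3 -> R^o) x (delta_mx 0 a).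

Lemma eq_partial D f g x a : open D -> (forall z, D z -> f z = g z) -> D x ->
  partial a f x = partial a g x.
Proof.
move=> oD fg Dx; apply: near_eq_derive.
by near=> z; apply: fg; near: z; exact: open_nbhs_nbhs.
Unshelve. all: by end_near. Qed.

Lemma partial_cst (k : R) x a : partial a (fun=> k) x = 0.
Proof. exact: (@derive_cst R 'rV[R]_3 R^o k x). Qed.

Lemma partialD f g x a : has_partial f x a -> has_partial g x a ->
  partial a (fun z => f z + g z) x = partial a f x + partial a g x.
Proof. exact: deriveD. Qed.

Lemma partialM f g x a : has_partial f x a -> has_partial g x a ->
  partial a (fun z => f z * g z) x = partial a f x * g x + f x * partial a g x.
Proof.
move=> df dg; apply: etrans (deriveM df dg) _.
by rewrite addrC; congr (_ + _); exact: mulrC.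
Qed.

Lemma has_partialD f g x a : has_partial f x a -> has_partial g x a ->
  has_partial (fun z => f z + g z) x a.
Proof. exact: derivableD. Qed.

Lemma has_partialM f g x a : has_partial f x a -> has_partial g x a ->
  has_partial (fun z => f z * g z) x a.
Proof. exact: derivableM. Qed.

Lemma has_partial_cst (k : R) x a : has_partial (fun=> k) x a.
Proof. exact: derivable_cst. Qed.

Lemma partial_sum (F : 'I_3 -> 'rV[R]_3 -> R) x a :
  (forall k, has_partial (F k) x a) ->
  partial a (fun z => \sum_k F k z) x = \sum_k partial a (F k) x.
Proof.
move=> dF; under eq_fun do rewrite sum3.
by rewrite sum3 (partialD (has_partialD (dF o0) (dF o1)) (dF o2))
  (partialD (dF o0) (dF o1)).
Qed.

Lemma has_partial_sum (F : 'I_3 -> 'rV[R]_3 -> R) x a :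
  (forall k, has_partial (F k) x a) ->
  has_partial (fun z => \sum_k F k z) x a.
Proof.
move=> dF; under eq_fun do rewrite sum3.
exact: has_partialD (has_partialD (dF o0) (dF o1)) (dF o2).
Qed.

Lemma smooth_has_partial D f x a : smooth_on D f -> D x -> has_partial f x a.
Proof. by move=> sf Dx; exact: (sf [::] x Dx).2. Qed.

Lemma smooth_partial D f a : smooth_on D f -> smooth_on D (partial a f).
Proof.
move=> sf s; suff -> : iter_partial s (partial a f) = iter_partial (rcons s a) f.
  exact: sf.
by rewrite /iter_partial foldr_rcons.
Qed.

Lemma partial_swap D f x a b : open D -> smooth_on D f -> D x ->
  partial a (partial b f) x = partial b (partial a f) x.
Proof.
move=> oD sf Dx; apply: derive_swap.
- near=> z; have Dz : D z by near: z; exact: open_nbhs_nbhs.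
  split; [exact: (sf [::] z Dz).2|exact: (sf [::] z Dz).2|
    exact: (sf [:: b] z Dz).2|exact: (sf [:: a] z Dz).2].
- by have [] := sf [:: a; b] x Dx.
- by have [] := sf [:: b; a] x Dx.
Unshelve. all: by end_near. Qed.

Lemma iter_partial_cst (k : R) s :
  exists c, iter_partial s (fun=> k) = (fun=> c).
Proof.
elim: s => [|a s [c IH]]; first by exists k.
by exists 0; rewrite /= IH; apply/funext => z; exact: partial_cst.
Qed.

Lemma smooth_cst D (k : R) : smooth_on D (fun=> k).
Proof.
move=> s x _; have [c ->] := iter_partial_cst k s; split; first exact: cst_continuous.
by move=> a; exact: has_partial_cst.
Qed.

Lemma partial_coord x a b :
  partial a (fun z : 'rV[R]_3 => z 0 b) x = (a == b)%:R.
Proof.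
have dI := @derivable_id R 'rV[R]_3 x (delta_mx 0 a).
have := congr1 (fun M : 'rV[R]_3 => M 0 b) (derive_mx dI).
by rewrite derive_id !mxE /= eq_sym => ->.
Qed.

Lemma has_partial_coord x a b : has_partial (fun z : 'rV[R]_3 => z 0 b) x a.
Proof.
have dI := @derivable_id R 'rV[R]_3 x (delta_mx 0 a).
exact: (proj1 (derivable_mxP _ _ _) dI 0 b).
Qed.

Lemma smooth_coord D b : smooth_on D (fun z : 'rV[R]_3 => z 0 b).
Proof.
move=> s x _; case/lastP: s => [|s a].
  by split; [exact: coord_continuous|move=> a; exact: has_partial_coord].
rewrite /iter_partial foldr_rcons.
have -> : partial a (fun z : 'rV[R]_3 => z 0 b) = (fun=> (a == b)%:R).
  by apply/funext => z; exact: partial_coord.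
exact: (@smooth_cst setT).
Qed.

End Partial.

Arguments smooth_has_partial {R D f x} a _ _.
Arguments eq_partial {R D f g x a} _ _ _.
Arguments has_partial_cst {R} k x a.
Arguments has_partialM {R f g x a} _ _.
Arguments smooth_partial {R D f} a _.
Arguments partialM {R f g x a} _ _.
Arguments partialD {R f g x a} _ _.
Arguments has_partialD {R f g x a} _ _.
Arguments has_partial_sum {R F x a} _.

(** * Skew pairs of indices in dimension three *)

Section Algebra.
Variable F : realFieldType.
Implicit Types (G h : 'I_3 -> 'I_3 -> F) (a b c d e p q r : 'I_3).

Definition lc a b c : F :=
  match val a, val b, val c with
  | 0, 1, 2 | 1, 2, 0 | 2, 0, 1 => 1
  | 0, 2, 1 | 1, 0, 2 | 2, 1, 0 => -1
  | _, _, _ => 0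
  end.

Definition dual (M : 'I_3 -> 'I_3 -> F) p : F :=
  2^-1 * \sum_a \sum_b lc a b p * M a b.

Definition skew2 (M : 'I_3 -> 'I_3 -> F) := forall a b, M b a = - M a b.

Lemma skew2_diag M a : skew2 M -> M a a = 0.
Proof. by move=> /(_ a a) H; lra. Qed.

(** The index p stands for the pair (p + 1, p + 2) modulo 3. *)
Lemma dualE M : skew2 M ->
  [/\ dual M o0 = M o1 o2, dual M o1 = M o2 o0 & dual M o2 = M o0 o1].
Proof.
move=> sM; rewrite /dual !sum3 /lc /=.
by split; [have := sM o1 o2|have := sM o2 o0|have := sM o0 o1] => ->; field.
Qed.

(** Contraction with the Levi-Civita symbol identifies skew pairs of indices with
    single indices; this is where dimension three enters. *)
Lemma dualK M : skew2 M -> forall a b, M a b = \sum_p lc a b p * dual M p.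
Proof.
move=> sM a b; have [d0 d1 d2] := dualE sM; rewrite sum3 d0 d1 d2.
elim/ord3_ind: a; elim/ord3_ind: b; rewrite /lc /= ?(skew2_diag _ sM);
  rewrite ?(sM o0 o1) ?(sM o1 o2) ?(sM o2 o0); ring.
Qed.

Lemma eq_dual M M' p : (forall a b, M a b = M' a b) -> dual M p = dual M' p.
Proof.
move=> E; rewrite /dual; congr (_ * _).
by apply: eq_bigr => a _; apply: eq_bigr => b _; rewrite E.
Qed.

Lemma dual_sum (M : 'I_3 -> 'I_3 -> 'I_3 -> F) (k : 'I_3 -> F) p :
  dual (fun a b => \sum_q k q * M q a b) p = \sum_q k q * dual (M q) p.
Proof. rewrite /dual !sum3; ring. Qed.

(** The two summands of V for a metric: with G the dual of the curvature in both
    skew pairs and h the inverse metric, V^{ab}_c is a multiple of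
    u^{ab}_c + u^{ba}_c. *)
Definition upart G h a b c : F := \sum_e \sum_q G a q * lc e c q * h b e.

Lemma lc_contract (T : 'I_3 -> 'I_3 -> 'I_3 -> F) :
  [/\ \sum_p \sum_q \sum_r lc p q o0 * T p q r = \sum_r (T o1 o2 r - T o2 o1 r),
      \sum_p \sum_q \sum_r lc p q o1 * T p q r = \sum_r (T o2 o0 r - T o0 o2 r) &
      \sum_p \sum_q \sum_r lc p q o2 * T p q r = \sum_r (T o0 o1 r - T o1 o0 r)].
Proof. by split; rewrite !sum3 /lc /=; ring. Qed.

(** A polynomial identity of degree two in G and in h.  It is visible when G and h are
    diagonal: then v a b c vanishes unless a, b, c are distinct, and the two terms
    left when a, b, c are distinct cancel by the symmetry of v. *)
Lemma upart_quadratic G h : (forall a b, G a b = G b a) ->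
  (forall a b, h a b = h b a) ->
  forall (v : 'I_3 -> 'I_3 -> 'I_3 -> F),
  (forall a b c, v a b c = upart G h a b c + upart G h b a c) ->
  forall a b c,
  \sum_p \sum_q \sum_r lc p q a * (v p r b * v q c r) +
  \sum_p \sum_q \sum_r lc p q b * (v p r a * v q c r) = 0.
Proof.
move=> Gs hs v vE a b c.
have v0 d e : v d e o0 = G d o1 * h e o2 - G d o2 * h e o1
                       + (G e o1 * h d o2 - G e o2 * h d o1).
  by rewrite vE /upart !sum3 /lc /=; ring.
have v1 d e : v d e o1 = G d o2 * h e o0 - G d o0 * h e o2
                       + (G e o2 * h d o0 - G e o0 * h d o2).
  by rewrite vE /upart !sum3 /lc /=; ring.
have v2 d e : v d e o2 = G d o0 * h e o1 - G d o1 * h e o0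
                       + (G e o0 * h d o1 - G e o1 * h d o0).
  by rewrite vE /upart !sum3 /lc /=; ring.
pose T b' c' p q r := v p r b' * v q c' r.
have [Sa0 Sa1 Sa2] := lc_contract (T b c).
have [Sb0 Sb1 Sb2] := lc_contract (T a c).
have G10 := Gs o1 o0; have G20 := Gs o2 o0; have G21 := Gs o2 o1.
have h10 := hs o1 o0; have h20 := hs o2 o0; have h21 := hs o2 o1.
(* For each value of a only two pairs (p, q) contribute to the contraction with eta. *)
rewrite /T in Sa0 Sa1 Sa2 Sb0 Sb1 Sb2 *.
elim/ord3_ind: a Sb0 Sb1 Sb2 => Sb0 Sb1 Sb2;
  elim/ord3_ind: b Sa0 Sa1 Sa2 => Sa0 Sa1 Sa2;
  rewrite ?(Sa0, Sa1, Sa2) ?(Sb0, Sb1, Sb2) !sum3;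
  elim/ord3_ind: c {Sa0 Sa1 Sa2 Sb0 Sb1 Sb2};
  rewrite !(v0, v1, v2) ?(G10, G20, G21, h10, h20, h21); ring.
Qed.

End Algebra.

Arguments lc {F} a b c.

(** * The Weyl tensor of a metric at a point *)

Section MetricCurvature.
Variables (F : realFieldType) (g h : 'I_3 -> 'I_3 -> F).
Variable K : 'I_3 -> 'I_3 -> 'I_3 -> 'I_3 -> F.
Implicit Types a b c d e p q r : 'I_3.

Hypothesis hs : forall a b, h a b = h b a.
Hypothesis hgK : forall a b, \sum_e h a e * g e b = (a == b)%:R.
Hypothesis K_skew : forall a b c d, K b a c d = - K a b c d.
Hypothesis K_bianchi : forall a b c d, K a b c d + K b d c a + K d a c b = 0.

Let L a b c d := \sum_e g c e * K a b e d.

Hypothesis L_skew : forall a b c d, L a b d c = - L a b c d.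

(** The double dual of the lowered curvature; up to sign and a volume factor this is
    the contravariant Einstein tensor. *)
Definition einstein p q := dual (fun a b => dual (L a b) q) p.

Let L_skew1 c d : skew2 (fun a b => L a b c d).
Proof. by move=> a b; rewrite /L !sum3 !(K_skew a b); ring. Qed.

Let L_bianchi a b c d : L a b c d + L b d c a + L d a c b = 0.
Proof.
rewrite /L !sum3.
have := K_bianchi a b o0 d; have := K_bianchi a b o1 d.
have := K_bianchi a b o2 d => /eqP; rewrite addr_eq0 => /eqP E2.
move=> /eqP; rewrite addr_eq0 => /eqP E1 /eqP; rewrite addr_eq0 => /eqP E0.
rewrite -[K d a o0 b]opprK -[K d a o1 b]opprK -[K d a o2 b]opprK -E0 -E1 -E2.
ring.
Qed.

Let dual_L_skew q : skew2 (fun a b => dual (L a b) q).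
Proof.
move=> a b; rewrite /dual !sum3 !(L_skew1 _ _ a b); ring.
Qed.

(** In terms of duals, the three nontrivial instances of the Bianchi identity are
    exactly the three off-diagonal equalities. *)
Lemma einstein_sym p q : einstein p q = einstein q p.
Proof.
have sL a b : skew2 (L a b) by move=> c d; exact: L_skew.
have E a b : [/\ dual (L a b) o0 = L a b o1 o2, dual (L a b) o1 = L a b o2 o0 &
  dual (L a b) o2 = L a b o0 o1] := dualE (sL a b).
have e0 r : einstein o0 r = dual (L o1 o2) r by case: (dualE (dual_L_skew r)).
have e1 r : einstein o1 r = dual (L o2 o0) r by case: (dualE (dual_L_skew r)).
have e2 r : einstein o2 r = dual (L o0 o1) r by case: (dualE (dual_L_skew r)).
have [_ E12 E12'] := E o1 o2; have [E20 _ E20'] := E o2 o0.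
have [E01 E01' _] := E o0 o1.
have L_zero a b c : L a b c c = 0 := skew2_diag _ (sL a b).
have eq01 : einstein o0 o1 = einstein o1 o0.
  rewrite e0 e1 E12 E20; have := L_bianchi o1 o2 o2 o0.
  by rewrite L_zero (L_skew _ _ o1 o2) => H; lra.
have eq02 : einstein o0 o2 = einstein o2 o0.
  rewrite e0 e2 E12' E01; have := L_bianchi o1 o2 o1 o0.
  by rewrite L_zero (L_skew _ _ o0 o1) => H; lra.
have eq12 : einstein o1 o2 = einstein o2 o1.
  rewrite e1 e2 E20' E01'; have := L_bianchi o1 o2 o0 o0.
  by rewrite L_zero (L_skew _ _ o2 o0) => H; lra.
by elim/ord3_ind: p; elim/ord3_ind: q.
Qed.

(** The curvature of a three-dimensional metric is recovered from its double dual: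
    undo the duality in the second skew pair and raise an index with h. *)
Lemma curvature_dual a b c :
  dual (fun d f => K d f b c) a = upart einstein h a b c.
Proof.
have KL d f : K d f b c = \sum_e h b e * L d f e c.
  rewrite -(sum_deltal (fun y => K d f y c)).
  under [RHS]eq_bigr do rewrite mulr_sumr.
  rewrite exchange_big; apply: eq_bigr => y _ /=.
  by rewrite -hgK mulr_suml; apply: eq_bigr => e _; rewrite mulrA.
rewrite (eq_dual _ KL) dual_sum /upart.
apply: eq_bigr => e _.
rewrite (eq_dual (M' := fun d f => \sum_q lc e c q * dual (L d f) q)).
  by rewrite dual_sum mulr_sumr; apply: eq_bigr => q _; rewrite /einstein; ring.
by move=> d f; apply: dualK => x y; exact: L_skew.
Qed.

Variables (S B : 'I_3 -> 'I_3 -> F) (W : 'I_3 -> 'I_3 -> 'I_3 -> 'I_3 -> F).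
Hypothesis B_skew : skew2 B.
Hypothesis WE : forall a b c d, W a b c d =
  K a b c d + (a == c)%:R * S b d - (b == c)%:R * S a d + B a b * (d == c)%:R.
Hypothesis W_tf1 : forall a b, \sum_k W k a k b = 0.
Hypothesis W_tf3 : forall a b, \sum_k W a b k k = 0.

Let w a b c := dual (fun d f => W d f b c) a.

Let W_skew b c : skew2 (fun d f => W d f b c).
Proof. by move=> d f; rewrite !WE K_skew B_skew; ring. Qed.

(** Written out, a vanishing trace over the first index pair equates two components
    of w, by the skew symmetry of W. *)
Let w_sym a b c : w a b c = w b a c.
Proof.
have w0 d : w o0 d c = W o1 o2 d c by case: (dualE (W_skew d c)).
have w1 d : w o1 d c = W o2 o0 d c by case: (dualE (W_skew d c)).
have w2 d : w o2 d c = W o0 o1 d c by case: (dualE (W_skew d c)).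
have W_diag d e : W d d e c = 0 := skew2_diag _ (W_skew e c).
have eq01 : w o0 o1 c = w o1 o0 c.
  by rewrite w0 w1; have := W_tf1 o2 c; rewrite sum3 (W_skew _ _ o2 o0) W_diag; lra.
have eq02 : w o0 o2 c = w o2 o0 c.
  by rewrite w0 w2; have := W_tf1 o1 c; rewrite sum3 (W_skew _ _ o1 o2) W_diag; lra.
have eq12 : w o1 o2 c = w o2 o1 c.
  by rewrite w1 w2; have := W_tf1 o0 c; rewrite sum3 (W_skew _ _ o0 o1) W_diag; lra.
by elim/ord3_ind: a; elim/ord3_ind: b.
Qed.

Let w_trace a : \sum_k w a k k = 0.
Proof.
transitivity (dual (fun d f => \sum_k 1 * W d f k k) a).
  by rewrite dual_sum; apply: eq_bigr => k _; rewrite mul1r.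
rewrite (eq_dual (M' := fun _ _ => 0)); last first.
  by move=> d f; under eq_bigr do rewrite mul1r; exact: W_tf3.
by rewrite /dual !sum3; ring.
Qed.

(** The S part of W - K is skew in ab after dualising, so the symmetry of w removes it;
    the B part then survives only as delta_c^b B^a + delta_c^a B^b, whose trace is
    4 B^a while the traces of the u part vanish, so B = 0. *)
Lemma weyl_dualE a b c :
  2 * w a b c = upart einstein h a b c + upart einstein h b a c.
Proof.
have wE d e f : w d e f = upart einstein h d e f
    + \sum_p lc e p d * S p f + (f == e)%:R * dual B d.
  rewrite -curvature_dual /w /dual !sum3 !WE.
  by elim/ord3_ind: d; elim/ord3_ind: e; rewrite /lc -!val_eqE /=; field.
have w2 d e k : 2 * w d e k = upart einstein h d e k + upart einstein h e d k
    + ((k == e)%:R * dual B d + (k == d)%:R * dual B e).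
  have -> : 2 * w d e k = w d e k + w e d k by rewrite -(w_sym d e); ring.
  rewrite !wE !sum3.
  by elim/ord3_ind: d; elim/ord3_ind: e; rewrite /lc /=; ring.
suff B0 d : dual B d = 0 by rewrite w2 !B0 !mulr0 !addr0.
have : 2 * \sum_k w d k k = 0 by rewrite w_trace mulr0.
rewrite mulr_sumr; under eq_bigr do rewrite w2.
rewrite /upart !sum3 !(einstein_sym o1 o0) !(einstein_sym o2 o0)
  !(einstein_sym o2 o1) !(hs o1 o0) !(hs o2 o0) !(hs o2 o1).
by elim/ord3_ind: d; rewrite /lc -!val_eqE /= => H; lra.
Qed.

End MetricCurvature.

(** * Curvature of a connection *)

(** Substitution of Gamma_a^b_c + U_a delta_c^b + delta_a^b U_c for Gamma in the
    curvature formula.  The first correction on the right is a torsion term; the two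
    brackets are the covariant derivative of U minus U_a U_d. *)
Lemma curvature_shift (F : comRingType) (Ga Gb : 'I_3 -> 'I_3 -> F)
    (dGa dGb dUa dUb U : 'I_3 -> F) (a b c d : 'I_3) :
  dGb d + (dUa b * (c == d)%:R + (b == c)%:R * dUa d)
  - (dGa d + (dUb a * (c == d)%:R + (a == c)%:R * dUb d))
  + \sum_e ((Ga c e + (U a * (c == e)%:R + (a == c)%:R * U e)) *
            (Gb e d + (U b * (e == d)%:R + (b == e)%:R * U d))
          - (Gb c e + (U b * (c == e)%:R + (b == c)%:R * U e)) *
            (Ga e d + (U a * (e == d)%:R + (a == e)%:R * U d)))
  = dGb d - dGa d + \sum_e (Ga c e * Gb e d - Gb c e * Ga e d)
  + (Ga c b - Gb c a) * U d
  - (a == c)%:R * (dUb d - \sum_e Gb e d * U e - U b * U d)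
  + (b == c)%:R * (dUa d - \sum_e Ga e d * U e - U a * U d)
  + (dUa b - dUb a) * (d == c)%:R.
Proof.
rewrite !sum3; elim/ord3_ind: c; elim/ord3_ind: d; elim/ord3_ind: a;
  elim/ord3_ind: b; rewrite -!val_eqE /=; ring.
Qed.

(** The commutator of covariant derivatives with its derivatives replaced by free
    variables: ddX is the mixed second derivative of X, and t the connection term on
    the lower index, which a torsion-free connection makes symmetric. *)
Lemma curvature_commutator (F : comRingType) (Ga Gb : 'I_3 -> 'I_3 -> F)
    (dGb dGa X dXa dXb : 'I_3 -> F) (ddX t : F) (c : 'I_3) :
  ddX + \sum_d (dGb d * X d + Gb c d * dXa d) - t
    + \sum_e Ga c e * (dXb e + \sum_d Gb e d * X d)
  - (ddX + \sum_d (dGa d * X d + Ga c d * dXb d) - t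
    + \sum_e Gb c e * (dXa e + \sum_d Ga e d * X d))
  = \sum_d (dGb d - dGa d + \sum_e (Ga c e * Gb e d - Gb c e * Ga e d)) * X d.
Proof. by rewrite !sum3; ring. Qed.

Lemma curvature_bianchi_alg (F : comRingType) (G : 'I_3 -> 'I_3 -> 'I_3 -> F)
    (dG : 'I_3 -> 'I_3 -> 'I_3 -> F) (c : 'I_3) :
  (forall a b d, G a b d = G d b a) -> (forall p a b, dG p a b = dG p b a) ->
  let K a b d := dG a b d - dG b a d
    + \sum_e (G a c e * G b e d - G b c e * G a e d) in
  forall a b d, K a b d + K b d a + K d a b = 0.
Proof.
move=> Gs dGs K a b d; rewrite /K !sum3.
rewrite (dGs d b a) (dGs a d b) (dGs b d a).
by rewrite !(Gs d _ a) !(Gs d _ b) !(Gs b _ a); ring.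
Qed.

(** Differentiate the metric compatibility condition d_b g_{cd} = Dg b c d once more and
    eliminate the first derivatives of g: skew-symmetrised in ab, the second
    derivatives DDg give the curvature with its last index pair symmetrised. *)
Lemma metric_curvature_skew_alg (F : comRingType)
    (g : 'I_3 -> 'I_3 -> F) (G : 'I_3 -> 'I_3 -> 'I_3 -> F)
    (dG : 'I_3 -> 'I_3 -> 'I_3 -> 'I_3 -> F) :
  (forall a b, g a b = g b a) ->
  let Dg a c d := \sum_e G a e c * g e d + \sum_e G a e d * g c e in
  let DDg a b c d := \sum_e (dG a b e c * g e d + G b e c * Dg a e d)
    + \sum_e (dG a b e d * g c e + G b e d * Dg a c e) in
  let K a b c d := dG a b c d - dG b a c d
    + \sum_e (G a c e * G b e d - G b c e * G a e d) in
  forall a b c d, DDg a b c d = DDg b a c d ->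
  \sum_e g d e * K a b e c = - \sum_e g c e * K a b e d.
Proof.
move=> gs Dg DDg K a b c d /eqP; rewrite -subr_eq0 => /eqP E.
apply/eqP; rewrite -addr_eq0; apply/eqP; apply: etrans _ E.
rewrite /DDg /Dg /K !sum3 !(gs o1 o0) !(gs o2 o0) !(gs o2 o1).
rewrite !(gs o0 d) !(gs o1 d) !(gs o2 d).
ring.
Qed.

Section Curvature.
Variables (R : realType) (M : manifold3 R).
Implicit Types (n : connection M) (i : atlas M) (x z : 'rV[R]_3).

Lemma open_chart_img i : open (chart_img (ch i)).
Proof. exact: chart_img_open. Qed.

Definition curvature n : tensor4 M := fun i x a b c d =>
  partial a (fun z => n i z b c d) x - partial b (fun z => n i z a c d) x
  + \sum_e (n i x a c e * n i x b e d - n i x b c e * n i x a e d).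

Lemma partial_cov_vec n i X x a b c : vfield i X -> chart_img (ch i) x ->
  partial a (fun z => cov_vec n i X z b c) x =
  partial a (partial b (fun z => X z c)) x +
  \sum_d (partial a (fun z => n i z b c d) x * X x d +
          n i x b c d * partial a (fun z => X z d) x).
Proof.
move=> sX Dx.
have dX d : has_partial (fun z => X z d) x a := smooth_has_partial a (sX d) Dx.
have dG d : has_partial (fun z => n i z b c d) x a :=
  smooth_has_partial a (@Gam_smooth _ _ n i b c d) Dx.
have dXb := smooth_has_partial a (smooth_partial b (sX c)) Dx.
have dGX d := has_partialM (dG d) (dX d).
rewrite /cov_vec (partialD dXb (has_partial_sum dGX)) (partial_sum dGX).
by congr (_ + _); apply: eq_bigr => d _; exact: partialM (dG d) (dX d).
Qed.

Lemma curvatureP n : torsion_free n -> is_curvature n (curvature n).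
Proof.
move=> tf i X sX x Dx a b c; rewrite /cov_mixed !partial_cov_vec //.
rewrite (partial_swap a b (@open_chart_img i) (sX c) Dx).
under [X in _ - (_ - X + _)]eq_bigr => d _ do rewrite (tf i x Dx b d a).
exact: (curvature_commutator (n i x a) (n i x b)
  (fun d => partial a (fun z => n i z b c d) x)
  (fun d => partial b (fun z => n i z a c d) x) (X x)
  (fun d => partial a (fun z => X z d) x) (fun d => partial b (fun z => X z d) x)).
Qed.

(** Testing against coordinate vector fields determines every component. *)
Lemma curvature_unique n Rm : torsion_free n -> is_curvature n Rm ->
  forall i x, chart_img (ch i) x -> forall a b c d,
  Rm i x a b c d = curvature n i x a b c d.
Proof.
move=> tf cR i x Dx a b c d.
pose X (z : 'rV[R]_3) (e : 'I_3) : R := (e == d)%:R.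
have sX : vfield i X by move=> e; exact: smooth_cst.
have E (T : 'I_3 -> R) : T d = \sum_e T e * X x e.
  by under eq_bigr do rewrite mulrC; rewrite sum_deltar.
rewrite [LHS](E (Rm i x a b c)) [RHS](E (curvature n i x a b c)).
by rewrite -(cR i X sX x Dx) (curvatureP tf sX Dx).
Qed.


(** The change of Christoffel symbols induced by a projective change, in one chart.
    U is not assumed to be a 1-form, so that differences of 1-forms are covered. *)
Definition proj_shift n n' i (U : 'rV[R]_3 -> 'I_3 -> R) :=
  forall x, chart_img (ch i) x -> forall a b c,
    n' i x a b c = n i x a b c + (U x a * (b == c)%:R + (a == b)%:R * U x c).

Lemma proj_equiv_shift n n' (U : oneform M) :
  (forall i X, vfield i X -> forall x, chart_img (ch i) x -> forall a b,
      cov_vec n' i X x a b = cov_vec n i X x a b + U i x a * X x b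
      + (a == b)%:R * \sum_c U i x c * X x c) ->
  forall i, proj_shift n n' i (U i).
Proof.
move=> E i x Dx a b c.
pose X (z : 'rV[R]_3) (e : 'I_3) : R := (e == c)%:R.
have sX : vfield i X by move=> e; exact: smooth_cst.
have sumX (T : 'I_3 -> R) : \sum_e T e * X x e = T c.
  by under eq_bigr do rewrite mulrC; rewrite sum_deltar.
have := E i X sX x Dx a b.
by rewrite /cov_vec partial_cst !sumX !add0r addrA.
Qed.

Lemma proj_shift_sub n n1 n2 i U1 U2 :
  proj_shift n n1 i U1 -> proj_shift n n2 i U2 ->
  proj_shift n1 n2 i (fun x a => U2 x a - U1 x a).
Proof. by move=> E1 E2 x Dx a b c; rewrite E1 // E2 //; ring. Qed.

(** A projective change alters the curvature only by trace terms, with - A the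
    change of the projective Schouten tensor and B = dU. *)
Lemma curvature_proj_shift n n' i U x : torsion_free n -> proj_shift n n' i U ->
  chart_img (ch i) x -> (forall a b, has_partial (fun z => U z b) x a) ->
  forall a b c d,
  let A a d := partial a (fun z => U z d) x - \sum_e n i x a e d * U x e
               - U x a * U x d in
  let B a b := partial a (fun z => U z b) x - partial b (fun z => U z a) x in
  curvature n' i x a b c d = curvature n i x a b c d
    - (a == c)%:R * A b d + (b == c)%:R * A a d + B a b * (d == c)%:R.
Proof.
move=> tf E Dx dU a b c d A B.
have dn' p q : partial p (fun z => n' i z q c d) x =
    partial p (fun z => n i z q c d) x +
    (partial p (fun z => U z q) x * (c == d)%:R +
     (q == c)%:R * partial p (fun z => U z d) x).
  rewrite (eq_partial (@open_chart_img i) (fun z Dz => E z Dz q c d) Dx).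
  have dG : has_partial (fun z => n i z q c d) x p :=
    smooth_has_partial p (@Gam_smooth _ _ n i q c d) Dx.
  have d1 := has_partialM (dU p q) (has_partial_cst (c == d)%:R x p).
  have d2 := has_partialM (has_partial_cst (q == c)%:R x p) (dU p d).
  rewrite (partialD dG (has_partialD d1 d2)) (partialD d1 d2).
  rewrite (partialM (dU p q) (has_partial_cst _ _ _)).
  rewrite (partialM (has_partial_cst _ _ _) (dU p d)) !partial_cst.
  by rewrite mulr0 addr0 mul0r add0r.
rewrite /curvature !dn'; under eq_bigr => e _ do rewrite !E //.
apply: etrans (curvature_shift (n i x a) (n i x b)
  (fun d => partial b (fun z => n i z a c d) x)
  (fun d => partial a (fun z => n i z b c d) x)
  (fun d => partial a (fun z => U z d) x) (fun d => partial b (fun z => U z d) x)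
  (U x) a b c d) _.
by rewrite (tf i x Dx a c b) subrr mul0r addr0.
Qed.

Lemma curvature_skew n i x a b c d :
  curvature n i x b a c d = - curvature n i x a b c d.
Proof.
rewrite /curvature opprD opprB -sumrN; congr (_ + _).
by apply: eq_bigr => e _; rewrite opprB.
Qed.

Lemma curvature_bianchi n i x : torsion_free n -> chart_img (ch i) x ->
  forall a b c d, curvature n i x a b c d + curvature n i x b d c a
                  + curvature n i x d a c b = 0.
Proof.
move=> tf Dx a b c d.
apply: (curvature_bianchi_alg (G := n i x)
  (dG := fun p a b => partial p (fun z => n i z a c b) x)).
  by move=> p q r; exact: tf.
move=> p q r.
exact: (eq_partial (@open_chart_img i) (fun z Dz => tf i z Dz q c r) Dx).
Qed.

(** The partial derivatives of g commute, and metric compatibility holds on a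
    neighbourhood of x, so it may be differentiated. *)
Lemma levi_civita_skew (g : pseudo_metric M) n i x :
  levi_civita g n -> chart_img (ch i) x -> forall a b c d,
  \sum_e g i x d e * curvature n i x a b e c =
  - \sum_e g i x c e * curvature n i x a b e d.
Proof.
move=> [tf lc] Dx a b c d.
have Dg p z q r : chart_img (ch i) z -> partial p (fun z => g i z q r) z =
    \sum_e n i z p e q * g i z e r + \sum_e n i z p e r * g i z q e.
  move=> Dz; have /eqP := lc i z Dz p q r.
  by rewrite /cov_metric -addrA -opprD subr_eq0 => /eqP.
have dg p q r : has_partial (fun z => g i z q r) x p :=
  smooth_has_partial p (@g_smooth _ _ g i q r) Dx.
have dn s p q r : has_partial (fun z => n i z p q r) x s :=
  smooth_has_partial s (@Gam_smooth _ _ n i p q r) Dx.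
pose Dgx p q r := \sum_e n i x p e q * g i x e r + \sum_e n i x p e r * g i x q e.
have DDg p q r s : partial p (partial q (fun z => g i z r s)) x =
    \sum_e (partial p (fun z => n i z q e r) x * g i x e s
           + n i x q e r * Dgx p e s)
  + \sum_e (partial p (fun z => n i z q e s) x * g i x r e
           + n i x q e s * Dgx p r e).
  rewrite (eq_partial (@open_chart_img i) (fun z Dz => Dg q z r s Dz) Dx).
  have d1 e := has_partialM (dn p q e r) (dg p e s).
  have d2 e := has_partialM (dn p q e s) (dg p r e).
  rewrite (partialD (has_partial_sum d1) (has_partial_sum d2)).
  rewrite (partial_sum d1) (partial_sum d2).
  congr (_ + _); apply: eq_bigr => e _.
    by rewrite (partialM (dn p q e r) (dg p e s)) (Dg p x e s Dx).
  by rewrite (partialM (dn p q e s) (dg p r e)) (Dg p x r e Dx).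
have swap := partial_swap a b (@open_chart_img i) (@g_smooth _ _ g i c d) Dx.
apply: (metric_curvature_skew_alg (g := g i x) (G := n i x)
  (dG := fun p q r s => partial p (fun z => n i z q r s) x)).
  by move=> p q; exact: (g_sym _ Dx).
by rewrite !DDg in swap.
Qed.

End Curvature.

(** * Vanishing of Q for metrisable structures *)

Lemma skew3E (R : realType) (t : 'I_3 -> 'I_3 -> 'I_3 -> R) : skew3 t ->
  forall a b c, t a b c = t o0 o1 o2 * lc a b c.
Proof.
move=> sk.
have s1 a b c : t b a c = - t a b c by have [] := sk a b c.
have s2 a b c : t a c b = - t a b c by have [] := sk a b c.
have t1 a c : t a a c = 0 by have := s1 a a c; lra.
have t2 a c : t a c c = 0 by have := s2 a c c; lra.
have t3 a c : t a c a = 0 by rewrite s1 t2 oppr0.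
have t102 : t o1 o0 o2 = - t o0 o1 o2 by exact: s1.
have t021 : t o0 o2 o1 = - t o0 o1 o2 by exact: s2.
have t120 : t o1 o2 o0 = t o0 o1 o2 by rewrite s2 t102 opprK.
have t201 : t o2 o0 o1 = t o0 o1 o2 by rewrite s1 t021 opprK.
have t210 : t o2 o1 o0 = - t o0 o1 o2 by rewrite s1 t120.
move=> a b c; elim/ord3_ind: a; elim/ord3_ind: b; elim/ord3_ind: c;
  rewrite /lc /= ?mulr0 ?mulr1 ?mulrN1; auto.
Qed.

Lemma metric_inverse (F : fieldType) (g : 'I_3 -> 'I_3 -> F) :
  (forall a b, g a b = g b a) -> \det (\matrix_(a, b) g a b) != 0 ->
  exists h : 'I_3 -> 'I_3 -> F, (forall a b, h a b = h b a) /\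
    forall a b, \sum_e h a e * g e b = (a == b)%:R.
Proof.
move=> gs dg; set A := \matrix_(a, b) g a b in dg.
have uA : A \in unitmx by rewrite unitmxE unitfE.
have As : A^T = A by apply/matrixP => a b; rewrite !mxE gs.
exists (fun a b => invmx A a b); split=> a b.
  by rewrite -{1}As -trmx_inv mxE.
have := congr1 (fun B : 'M[F]_3 => B a b) (mulVmx uA).
by rewrite !mxE => <-; apply: eq_bigr => e _; rewrite !mxE.
Qed.

Section Metrisable.
Variables (R : realType) (M : manifold3 R).

Lemma VtensorE (e : trivector M) (W : tensor4 M) i x a b c :
  chart_img (ch i) x -> Vtensor e W i x a b c =
    e i x o0 o1 o2 * (2 * dual (fun d f => W i x d f b c) a).
Proof.
move=> Dx; rewrite /Vtensor /dual mulVKf ?pnatr_eq0 // mulr_sumr.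
apply: eq_bigr => d _; rewrite mulr_sumr; apply: eq_bigr => f _.
by rewrite (skew3E (tv_skew e Dx)) mulrA.
Qed.

(** Both volume elements enter Q only through a scalar factor, so Q may be computed
    with the Levi-Civita symbol. *)
Lemma QtensorE (e : trivector M) (e' : threeform M) (W : tensor4 M) i x a b c
    (v : 'I_3 -> 'I_3 -> 'I_3 -> R) : chart_img (ch i) x ->
  (forall p q r, 2 * dual (fun d f => W i x d f q r) p = v p q r) ->
  Qtensor e e' W i x a b c =
    2^-1 * (e' i x o0 o1 o2 * e i x o0 o1 o2 ^+ 2) *
    (\sum_p \sum_q \sum_r lc p q a * (v p r b * v q c r) +
     \sum_p \sum_q \sum_r lc p q b * (v p r a * v q c r)).
Proof.
move=> Dx vE; rewrite /Qtensor -mulrA; congr (_ * _); rewrite mulrDr.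
have E s t : \sum_p \sum_q \sum_r e' i x p q s * Vtensor e W i x p r t *
    Vtensor e W i x q c r = e' i x o0 o1 o2 * e i x o0 o1 o2 ^+ 2 *
    (\sum_p \sum_q \sum_r lc p q s * (v p r t * v q c r)).
  rewrite mulr_sumr; apply: eq_bigr => p _.
  rewrite mulr_sumr; apply: eq_bigr => q _.
  rewrite mulr_sumr; apply: eq_bigr => r _.
  rewrite !(VtensorE _ _ _ _ _ Dx) !vE (skew3E (tf_skew e' Dx)).
  move: (e' i x _ _ _) (e i x _ _ _) (v _ _ _) (v _ _ _) (lc _ _ _) => k l m n o.
  ring.
by rewrite !E.
Qed.

(** The Weyl tensor may be computed from a connection n0 other than the Levi-Civita
    connection n; both differ from a common connection by a projective shift, hence
    from each other, and the shift is absorbed in S and B. *)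
Theorem metrisable_Qtensor (P : projective_structure M) (W : tensor4 M)
    (e : trivector M) (e' : threeform M) :
  projective_weyl P W -> metrisable P ->
  forall i x, chart_img (ch i) x -> forall a b c, Qtensor e e' W i x a b c = 0.
Proof.
move=> [n0 [Pn0 [Rm [Sc [cR WE]]]]] [g [n [Pn lc_g]]] i x Dx a b c.
have [n1 tf1 Pcl] := pclassP P; rewrite {}Pcl in Pn0 Pn.
case: Pn0 => tf0 [U0 E0]; case: Pn => tf [U E].
have sh := proj_shift_sub (@proj_equiv_shift _ _ _ _ _ E i)
  (@proj_equiv_shift _ _ _ _ _ E0 i).
have dU p q : has_partial (fun z => U0 i z q - U i z q) x p.
  apply: derivableB; first exact: (smooth_has_partial p (@of_smooth _ _ U0 i q) Dx).
  exact: (smooth_has_partial p (@of_smooth _ _ U i q) Dx).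
have K0 := curvature_proj_shift tf sh Dx dU.
have [Wtf WE'] := WE i x Dx.
have gs := g_sym g Dx.
have [h [hs hgK]] := metric_inverse gs (g_nondeg g Dx).
pose u z p := U0 i z p - U i z p.
pose S q s := - (partial q (fun z => u z s) x - \sum_e n i x q e s * u x e
                 - u x q * u x s) - Sc i x q s.
pose B p q := partial p (fun z => u z q) x - partial q (fun z => u z p) x
              - (Sc i x q p - Sc i x p q).
have WK p q r s : W i x p q r s = curvature n i x p q r s + (p == r)%:R * S q s
    - (q == r)%:R * S p s + B p q * (s == r)%:R.
  have := WE' p q r s; rewrite (curvature_unique tf0 cR Dx) K0 /S /B /u /=.
  move: (curvature n i x p q r s) (partial _ _ _) (partial _ _ _)
    (partial _ _ _) (partial _ _ _) => k p1 p2 p3 p4.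
  move: (\sum_e _) (\sum_e _) => s1 s2.
  by move/eqP; rewrite -!addrA -subr_eq => /eqP <-; ring.
have Bs : skew2 B.
  rewrite /B => p q.
  by move: (partial _ _ _) (partial _ _ _) => p1 p2; ring.
have tf1' p q : \sum_k W i x k p k q = 0 by have [] := Wtf p q.
have tf3' p q : \sum_k W i x p q k k = 0 by have [] := Wtf p q.
have vE := weyl_dualE hs hgK (@curvature_skew _ _ n i x)
  (curvature_bianchi tf Dx) (fun a b c d => levi_civita_skew lc_g Dx a b c d)
  Bs WK tf1' tf3'.
rewrite (QtensorE e e' a b c Dx vE).
have Gs := einstein_sym (@curvature_skew _ _ n i x)
  (curvature_bianchi tf Dx) (fun a b c d => levi_civita_skew lc_g Dx a b c d).
by rewrite (upart_quadratic Gs hs (fun _ _ _ => erefl)) mulr0.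
Qed.

End Metrisable.

(** * A projective structure on R^3 with Q different from zero *)

(** The balls with rational centre and radius 1/(k + 1) form a basis. *)
Lemma rV_second_countable (R : realType) n : @second_countable 'rV[R]_n.
Proof.
pose f (p : 'rV[rat]_n * nat) : set 'rV[R]_n :=
  ball (map_mx ratr p.1 : 'rV[R]_n) p.2.+1%:R^-1.
exists (f @` setT).
  exact: sub_countable (card_image_le _ _) (countableP _).
split=> [_ [p _ <-]|x A /nbhs_ballP[e /= e0 xeA]]; first exact: ball_open.
have [//|k] := @ltr_add_invr R 0 (e / 2) _; first by rewrite divr_gt0.
rewrite add0r => ke; set r := k.+1%:R^-1 in ke.
have r0 : 0 < r by rewrite invr_gt0.
(* A rational point just to the right of x in every coordinate. *)
have q_ i : {q : rat | ratr q \in `](x 0 i), (x 0 i + r)[}.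
  by apply/cid/rat_in_itvoo; rewrite ltrDl.
pose q : 'rV[rat]_n := \row_i sval (q_ i).
have xq : ball (map_mx ratr q : 'rV[R]_n) r x.
  split=> // i j; rewrite !mxE ord1 /ball /=.
  have := svalP (q_ j); set y := ratr _ => /itvP yx.
  by rewrite ger0_norm ?subr_ge0 ?yx // ltrBlDl yx.
exists (f (q, k)); first by split; [exists (q, k)|].
move=> z qz; apply: xeA; rewrite [e]splitr.
by apply: ball_triangle (le_ball (ltW ke) (ball_sym xq)) (le_ball (ltW ke) qz).
Qed.

Section Example.
Variable R : realType.

Lemma id_cts (D : set 'rV[R]_3) x : D x -> {for x, continuous (@id 'rV[R]_3)}.
Proof. by move=> _; exact: cvg_id. Qed.

Lemma id_img_open : open (@id 'rV[R]_3 @` setT).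
Proof. by rewrite image_id; exact: openT. Qed.

Definition eucl_chart : chart R 'rV[R]_3 :=
  @Chart R 'rV[R]_3 setT id id openT id_img_open
    (@id_cts setT) (@id_cts (id @` setT)) (fun p _ => erefl).

Lemma eucl_transition_smooth (i j : unit) (b : 'I_3) :
  smooth_on (overlap eucl_chart eucl_chart)
    (fun x => transition eucl_chart eucl_chart x 0 b).
Proof. exact: smooth_coord. Qed.

Definition eucl3 : manifold3 R :=
  @Manifold3 R 'rV[R]_3 (@norm_hausdorff R 'rV[R]_3) (@rV_second_countable R 3)
    unit (fun=> eucl_chart) (fun p => ex_intro _ tt I) eucl_transition_smooth.

Lemma eucl_jac x a b : jac eucl_chart eucl_chart x a b = (a == b)%:R.
Proof. exact: partial_coord. Qed.

Lemma eucl_push (F : 'I_3 -> 'I_3 -> 'I_3 -> R) x a' b' c' :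
  let J := jac eucl_chart eucl_chart x in
  \sum_a \sum_b \sum_c J a a' * J b b' * J c c' * F a b c = F a' b' c'.
Proof.
move=> J; rewrite -[RHS](sum_deltar (fun a => F a b' c')); apply: eq_bigr => a _.
rewrite -[in RHS](sum_deltar (fun b => F a b c')) mulr_sumr.
apply: eq_bigr => b _; rewrite -[in RHS](sum_deltar (fun c => F a b c)).
rewrite !mulr_sumr; apply: eq_bigr => c _.
by rewrite /J !eucl_jac !mulrA.
Qed.

Lemma eucl_pull (F : 'I_3 -> 'I_3 -> 'I_3 -> R) x a b c :
  let J := jac eucl_chart eucl_chart x in
  \sum_a' \sum_b' \sum_c' J a a' * J b b' * J c c' * F a' b' c' = F a b c.
Proof.
move=> J; rewrite -[RHS](sum_deltal (fun a' => F a' b c)); apply: eq_bigr => a' _.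
rewrite -[in RHS](sum_deltal (fun b' => F a' b' c)) mulr_sumr.
apply: eq_bigr => b' _; rewrite -[in RHS](sum_deltal (fun c' => F a' b' c')).
rewrite !mulr_sumr; apply: eq_bigr => c' _.
by rewrite /J !eucl_jac !mulrA.
Qed.

Lemma lc_skew : skew3 (@lc R).
Proof.
by move=> a b c; split; elim/ord3_ind: a; elim/ord3_ind: b; elim/ord3_ind: c;
  rewrite /lc /= ?opprK ?oppr0.
Qed.

Definition zero_form : oneform eucl3.
Proof.
exists (fun _ _ _ => 0) => [i a|i j x _ a]; first exact: smooth_cst.
by rewrite sum3 !mulr0 !addr0.
Defined.

Definition volume_vec : trivector eucl3.
Proof.
exists (fun _ _ => lc) => [i a b c|i x _|i j x _ a' b' c'].
- exact: smooth_cst.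
- exact: lc_skew.
- by rewrite [RHS]eucl_push.
Defined.

Definition volume_form : threeform eucl3.
Proof.
exists (fun _ _ => lc) => [i a b c|i x _|i j x _ a b c].
- exact: smooth_cst.
- exact: lc_skew.
- by rewrite [RHS]eucl_pull.
Defined.

(** Gamma_a^{a+1}_a = 1, indices modulo 3. *)
Definition cyc (a b c : 'I_3) : R :=
  match val a, val b, val c with
  | 0, 1, 0 | 1, 2, 1 | 2, 0, 2 => 1
  | _, _, _ => 0
  end.

Definition cyc_conn : connection eucl3.
Proof.
exists (fun _ _ => cyc) => [i a b c|i j x _ a b' c]; first exact: smooth_cst.
rewrite (_ : (fun z => _) = fun=> (c == b')%:R); last first.
  by apply/funext => z; exact: eucl_jac.
rewrite partial_cst add0r.
have -> : \sum_b cyc a b c * jac eucl_chart eucl_chart x b b' = cyc a b' c.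
  rewrite -[RHS](sum_deltar (fun b => cyc a b c)).
  by apply: eq_bigr => b _; rewrite eucl_jac mulrC.
rewrite -[LHS](sum_deltal (fun a' => cyc a' b' c)); apply: eq_bigr => a' _.
rewrite -[in LHS](sum_deltal (fun c' => cyc a' b' c')) mulr_sumr.
by apply: eq_bigr => c' _; rewrite !eucl_jac mulrA.
Defined.

Lemma cyc_torsion_free : torsion_free cyc_conn.
Proof.
by move=> i x _ a b c /=; elim/ord3_ind: a; elim/ord3_ind: b; elim/ord3_ind: c.
Qed.

Lemma cyc_curvature i x a b c d : curvature cyc_conn i x a b c d =
  \sum_e (cyc a c e * cyc b e d - cyc b c e * cyc a e d).
Proof. by rewrite /curvature /= !partial_cst subrr add0r. Qed.

Lemma cyc_trace_free i x : trace_free (curvature cyc_conn i x).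
Proof.
move=> a b; split; under eq_bigr do rewrite cyc_curvature; rewrite !sum3;
  by elim/ord3_ind: a; elim/ord3_ind: b; rewrite /cyc /=; ring.
Qed.

Lemma proj_equiv_refl (n : connection eucl3) : proj_equiv n n.
Proof.
exists zero_form => i X _ x _ a b /=.
by rewrite sum3 !mul0r !addr0 mulr0 addr0.
Qed.

Definition cyc_structure : projective_structure eucl3.
Proof.
exists [set n | torsion_free n /\ proj_equiv cyc_conn n].
by exists cyc_conn => //; exact: cyc_torsion_free.
Defined.

Lemma cyc_weyl : projective_weyl cyc_structure (curvature cyc_conn).
Proof.
exists cyc_conn; split.
  by split; [exact: cyc_torsion_free|exact: proj_equiv_refl].
exists (curvature cyc_conn), (fun _ _ _ _ => 0); split.
  exact: curvatureP cyc_torsion_free.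
move=> i x _; split; first exact: cyc_trace_free.
by move=> a b c d /=; rewrite subrr !mulr0 mul0r subr0 !addr0.
Qed.

Lemma volume_nowhere_vanishing : nowhere_vanishing volume_vec.
Proof. by move=> i x _; exists o0, o1, o2; rewrite /= /lc /= oner_neq0. Qed.

Lemma volume_dual : dual_threeform volume_vec volume_form.
Proof. by move=> i x _; rewrite !sum3 /= /lc /=; ring. Qed.

Lemma cyc_Qtensor :
  Qtensor volume_vec volume_form (curvature cyc_conn) tt 0 o0 o0 o1 = - 4.
Proof.
have Dx : chart_img (ch (m := eucl3) tt) 0 by exists 0.
pose K d f q r : R := \sum_e (cyc d q e * cyc f e r - cyc f q e * cyc d e r).
have sK q r : skew2 (fun d f => K d f q r).
  by move=> d f; rewrite /K -sumrN; apply: eq_bigr => e _; rewrite opprB.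
pose v p q r := 2 * dual (fun d f => K d f q r) p.
rewrite (@QtensorE _ _ _ _ _ _ _ _ _ _ v Dx); last first.
  by move=> p q r; congr (_ * _); apply: eq_dual => d f; rewrite cyc_curvature.
have [-> _ _] := lc_contract (fun p q r => v p r o0 * v q o1 r).
have v1 q r : v o1 q r = 2 * K o2 o0 q r by rewrite /v; have [_ ->] := dualE (sK q r).
have v2 q r : v o2 q r = 2 * K o0 o1 q r by rewrite /v; have [_ _ ->] := dualE (sK q r).
by rewrite !sum3 !v1 !v2 /K !sum3 /= /cyc /lc /=; field.
Qed.

End Example.

Theorem theorem1p3 (R : realType) :
  (forall (M : manifold3 R) (P : projective_structure M) (W : tensor4 M)
          (e : trivector M) (e' : threeform M),
      projective_weyl P W -> nowhere_vanishing e -> dual_threeform e e' ->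
      metrisable P ->
      forall (i : atlas M) (x : 'rV[R]_3), chart_img (ch i) x ->
      forall a b c : 'I_3, Qtensor e e' W i x a b c = 0)
  /\
  (exists (M : manifold3 R) (P : projective_structure M) (W : tensor4 M)
          (e : trivector M) (e' : threeform M),
      [/\ projective_weyl P W, nowhere_vanishing e, dual_threeform e e' &
      exists (i : atlas M) (x : 'rV[R]_3), chart_img (ch i) x /\
      exists a b c : 'I_3, Qtensor e e' W i x a b c <> 0]).
Proof.
split=> [M P W e e' PW _ _ mP i x Dx a b c|].
  exact: metrisable_Qtensor PW mP _ _ Dx _ _ _.
exists (eucl3 R), (cyc_structure R), (curvature (cyc_conn R)).
exists (volume_vec R), (volume_form R); split.
- exact: cyc_weyl.
- exact: volume_nowhere_vanishing.
- exact: volume_dual.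
exists tt, 0; split; first by exists 0.
exists o0, o0, o1; rewrite cyc_Qtensor.
by apply/eqP; rewrite oppr_eq0 pnatr_eq0.
Qed.
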